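(* Let $\sigma$ and $\tau$ be (possibly empty) non-crossing partitions, and let $\rho,\rho'$ be cc-equivalent non-crossing partitions. Then $\sigma[\rho][\tau]$ and $\sigma[\rho'][\tau]$ are cc-equivalent.
   Context: Set partitions are written in canonical sequential form (restricted growth words). A partition is non-crossing if it avoids the pattern $1212$ (pattern containment = having a subsequence order-isomorphic to the pattern). For partitions $\alpha,\beta$, $\alpha[\beta]$ is the concatenation of $\alpha$ with $\beta+r$, $r$ the number of blocks of $\alpha$ ($\beta+r$ adds $r$ to every letter); this is associative. A partition $\pi$ is connected if it cannot be written as $\alpha[\beta]$ with $\alpha,\beta$ nonempty; every partition is uniquely $\pi=\sigma_1[\sigma_2]\cdots[\sigma_m]$ with nonempty connected $\sigma_i$, its components. Two non-crossing patterns $\sigma,\tau$ are cc-equivalent if there is a bijection from the set of partitions avoiding both $1212$ and $\sigma$ to the set of partitions avoiding both $1212$ and $\tau$ that preserves size and number of components. *)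

(* Defs.v *)
From mathcomp Require Import all_boot.
Set Implicit Arguments. Unset Strict Implicit. Unset Printing Implicit Defensive.

(* A set partition of [n] is written in canonical sequential form
   (restricted growth word) with letters 1,2,...: the first letter is 1 and
   each letter is at most 1 + the maximum of the previous letters.
   The empty word is the empty partition. *)
Fixpoint rgw_from (m : nat) (s : seq nat) : bool :=
  if s is x :: t then (0 < x) && (x <= m.+1) && rgw_from (maxn m x) t else true.

Definition is_part (s : seq nat) : bool := rgw_from 0 s.

Definition nblocks (s : seq nat) : nat := foldr maxn 0 s.

Definition order_iso (s t : seq nat) : Prop :=
  size s = size t /\
  forall i j, i < size s -> j < size s ->
    (nth 0 s i < nth 0 s j) = (nth 0 t i < nth 0 t j).

Definition contains (s p : seq nat) : Prop :=
  exists m : bitseq, size m = size s /\ order_iso (mask m s) p.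

Definition avoids (s p : seq nat) : Prop := ~ contains s p.

Definition noncrossing (s : seq nat) : Prop := avoids s [:: 1; 2; 1; 2].

Definition pbracket (a b : seq nat) : seq nat := a ++ map (addn (nblocks a)) b.

Definition connected (p : seq nat) : Prop :=
  ~ exists a b, [/\ is_part a, is_part b, a <> [::], b <> [::] & p = pbracket a b].

(* p has exactly m components: p = s_1[s_2]...[s_m] with nonempty connected
   partitions s_i (this decomposition is unique). *)
Definition has_ncomp (p : seq nat) (m : nat) : Prop :=
  exists cs : seq (seq nat),
    [/\ size cs = m,
        forall c, c \in cs -> [/\ is_part c, c <> [::] & connected c]
      & p = foldl pbracket [::] cs].

Definition Av (sigma : seq nat) : Type :=
  {p : seq nat | [/\ is_part p, noncrossing p & avoids p sigma]}.

Definition cc_equiv (sigma tau : seq nat) : Prop :=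
  exists f : Av sigma -> Av tau,
    [/\ bijective f,
        forall x, size (proj1_sig (f x)) = size (proj1_sig x)
      & forall x m, has_ncomp (proj1_sig (f x)) m <-> has_ncomp (proj1_sig x) m].

(* Main.v *)
Require Import Defs.
From mathcomp Require Import all_boot.
From mathcomp Require Import zify.
From Stdlib Require Import Classical ClassicalEpsilon ProofIrrelevance.
Set Implicit Arguments. Unset Strict Implicit. Unset Printing Implicit Defensive.

(** In a non-crossing partition a letter [z] occurring before some [y < z] cannot
    occur again after it, because [y] also precedes the first [z].  So at any time
    the letters that may still be repeated form a stack, and its height is the
    number of components read so far.

    Prefix [sigma]: let [u] be the shortest prefix of [p] containing [sigma].
    Any letter that can continue a copy of [sigma] to one of [sigma[rho]] is
    new after [u], so [p] contains [sigma[rho]] iff the subword [q] of letters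
    after [u] larger than [max u] contains [rho].  The old letters after [u]
    can only be inserted between components of [q], so [q] may be replaced by
    its image under the given bijection.

    Suffix [tau]: let [t] be the largest letter such that the letters [>= t] of
    [p] contain [tau], and [q] the prefix before the first [t].  Then [p]
    contains [rho[tau]] iff [q] contains [rho].  The rest of [p] uses from [q]
    only the stack, i.e. one letter per component, so again [q] may be replaced
    by its image. *)

(** * Non-crossing words as runs of a stack machine *)

Definition push (S : seq nat) (x : nat) : seq nat := rcons [seq y <- S | y < x] x.

(* [M] is the largest letter read so far and [S], increasing, the stack of the
   letters that can be repeated without creating a crossing. *)
Fixpoint ncp_from (M : nat) (S s : seq nat) : bool :=
  if s is x :: t then
    ((x \in S) || (x == M.+1)) && ncp_from (maxn M x) (push S x) t
  else true.

Definition ncp (s : seq nat) : bool := ncp_from 0 [::] s.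

Definition stk (S s : seq nat) : seq nat := foldl push S s.

(** For non-crossing [s] this height is the number of components; [has_ncompP] identifies it with
    the decomposition into connected partitions. *)
Definition ncomp (s : seq nat) : nat := size (stk [::] s).

Lemma filter_eq_nil (T : eqType) (a : pred T) (s : seq T) :
  (forall x, x \in s -> ~~ a x) -> filter a s = [::].
Proof. by move/hasPn; rewrite has_filter negbK => /eqP. Qed.

Lemma mem_push S x y : (y \in push S x) = (y == x) || (y < x) && (y \in S).
Proof. by rewrite mem_rcons inE mem_filter. Qed.

Lemma nblocks_cat a b : nblocks (a ++ b) = maxn (nblocks a) (nblocks b).
Proof. by elim: a => [|x a IH] /=; rewrite ?max0n // IH maxnA. Qed.

Lemma leq_nblocks x s : x \in s -> x <= nblocks s.
Proof.
elim: s => //= y s IH; rewrite inE leq_max => /orP[/eqP->|/IH->]; first by rewrite leqnn.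
by rewrite orbT.
Qed.

Lemma nblocks_addn K s : s != [::] -> nblocks (map (addn K) s) = K + nblocks s.
Proof.
elim: s => //= x [|y s] IH _; first by rewrite /= !maxn0.
by rewrite IH // addn_maxr.
Qed.

Lemma stk_cat S a b : stk S (a ++ b) = stk (stk S a) b.
Proof. exact: foldl_cat. Qed.

Lemma ncp_from_cat M S a b :
  ncp_from M S (a ++ b) = ncp_from M S a && ncp_from (maxn M (nblocks a)) (stk S a) b.
Proof.
elim: a M S => [|x a IH] M S /=; first by rewrite maxn0.
by rewrite IH andbA maxnA.
Qed.

Lemma ncp_cat a b : ncp (a ++ b) = ncp a && ncp_from (nblocks a) (stk [::] a) b.
Proof. by rewrite /ncp ncp_from_cat max0n. Qed.

Lemma mem_stk S s x : x \in stk S s -> (x \in S) || (x \in s).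
Proof.
elim: s S => [|y s IH] S /=; first by move->.
move/IH; rewrite mem_push inE => /orP[/orP[->|/andP[_ ->]]|->]; by rewrite ?orbT.
Qed.

Lemma stk_leq s : all (fun x => x <= nblocks s) (stk [::] s).
Proof. by apply/allP => x /mem_stk /= /leq_nblocks. Qed.

Lemma stk_sorted S s : sorted ltn S -> sorted ltn (stk S s).
Proof.
elim: s S => //= x s IH S sS; apply: IH.
rewrite /push (sorted_pairwise ltn_trans) pairwise_rcons -(sorted_pairwise ltn_trans).
by rewrite filter_all (sorted_filter ltn_trans).
Qed.

Lemma ncp_from_mem M S s z : ncp_from M S s -> z \in s -> (z \in S) || (M < z).
Proof.
elim: s M S => //= x s IH M S /andP[xS /IH{}IH]; rewrite inE => /orP[/eqP->|/IH].
  by case/orP: xS => [->//|/eqP->]; rewrite ltnSn orbT.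
rewrite mem_push gtn_max => /orP[/orP[/eqP->|/andP[_ ->]]|/andP[-> _]]; rewrite ?orbT //.
by case/orP: xS => [->//|/eqP->]; rewrite ltnSn orbT.
Qed.

Lemma ncp_from_pos M S s : ncp_from M S s -> all (fun x => 0 < x) S -> all (fun x => 0 < x) s.
Proof.
move=> h /allP pS; apply/allP => x /(ncp_from_mem h)/orP[/pS//|]; exact: leq_ltn_trans.
Qed.

Lemma ncp_pos s : ncp s -> all (fun x => 0 < x) s.
Proof. by move/ncp_from_pos; apply. Qed.

(* Once a smaller letter [y] has been read, no earlier larger letter can return. *)
Lemma ncp_from_new_after M S a y b z :
  ncp_from M S (a ++ y :: b) -> y < z -> z \in b -> maxn M (nblocks a) < z.
Proof.
rewrite ncp_from_cat /= => /andP[_ /andP[_ h]] yz /(ncp_from_mem h).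
rewrite mem_push !gtn_max => /orP[|/andP[]//].
by rewrite gtn_eqF //= ltnNge (ltnW yz).
Qed.

Lemma ncp_new_after a y b z : ncp (a ++ y :: b) -> y < z -> z \in b -> nblocks a < z.
Proof. by move/ncp_from_new_after => h /h{}h /h; rewrite max0n. Qed.

Lemma containsP s p : contains s p <-> exists2 q, subseq q s & order_iso q p.
Proof.
split=> [[m [_ h]]|[q /subseqP[m sm ->] h]]; last by exists m.
by exists (mask m s) => //; apply: mask_subseq.
Qed.

Lemma contains_subseq s s' p : subseq s s' -> contains s p -> contains s' p.
Proof.
move=> ss /containsP[q qs h]; apply/containsP; exists q => //.
exact: subseq_trans qs ss.
Qed.

Lemma rgw_from_cat M a b :
  rgw_from M (a ++ b) = rgw_from M a && rgw_from (maxn M (nblocks a)) b.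
Proof.
elim: a M => [|x a IH] M /=; first by rewrite maxn0.
by rewrite IH maxnA !andbA.
Qed.

Lemma is_part_rcons s x : is_part (rcons s x) = is_part s && (0 < x <= (nblocks s).+1).
Proof. by rewrite /is_part -cats1 rgw_from_cat /= max0n !andbT. Qed.

Lemma is_part_pos s x : is_part s -> x \in s -> 0 < x.
Proof.
elim/last_ind: s => // s y IH; rewrite is_part_rcons mem_rcons inE.
by case/andP=> /IH{}IH /andP[y0 _] /orP[/eqP->|].
Qed.

Lemma is_part_mem s x : is_part s -> 0 < x <= nblocks s -> x \in s.
Proof.
elim/last_ind: s => [_|s y IH]; first by case: x.
rewrite is_part_rcons -cats1 nblocks_cat /= maxn0 mem_cat inE => /andP[ps y1] x1.
have [->|xy] := eqVneq x y; first by rewrite orbT.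
by rewrite IH //; lia.
Qed.

Lemma crossingP s :
  contains s [:: 1; 2; 1; 2] <-> exists x y, x < y /\ subseq [:: x; y; x; y] s.
Proof.
split=> [/containsP[q qs [sq h]]|[x [y [xy h]]]]; last first.
  apply/containsP; exists [:: x; y; x; y] => //; split=> // i j.
  case: i => [|[|[|[|//]]]]; case: j => [|[|[|[|//]]]] _ _ /=; lia.
case: q qs sq h => [|a [|b [|c [|d [|//]]]]] //= qs _ h.
have hab := h 0 1 isT isT; have hac := h 0 2 isT isT; have hca := h 2 0 isT isT.
have hbd := h 1 3 isT isT; have hdb := h 3 1 isT isT.
rewrite /= in hab hac hca hbd hdb.
exists a, b; split; first by rewrite hab.
by have -> : [:: a; b; a; b] = [:: a; b; c; d] by repeat congr cons; lia.
Qed.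

Lemma noncrossing_prefix a b : noncrossing (a ++ b) -> noncrossing a.
Proof. by move=> h /(contains_subseq (prefix_subseq a b)). Qed.

(** Only a smaller letter can pop [x]; that letter becomes the repeated small letter of a crossing
    in [ncpP]. *)
Lemma notin_stkP s x : x \in s -> x \notin stk [::] s ->
  exists a b y, [/\ s = a ++ x :: b, y \in b & y < x].
Proof.
elim/last_ind: s => // s z IH; rewrite mem_rcons inE -cats1 stk_cat /= mem_push negb_or.
move=> h /andP[xz]; rewrite (negPf xz) /= in h.
rewrite negb_and -leqNgt => /orP[zx|/(IH h)[a [b [y [-> yb yx]]]]].
  case/splitPr: h => a b; exists a, (rcons b z), z.
  by rewrite -catA cats1 mem_rcons inE eqxx ltn_neqAle eq_sym xz zx.
by exists a, (rcons b z), y; rewrite -catA cats1 mem_rcons inE yb orbT.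
Qed.

Lemma subseq_cat_split (q1 q2 s : seq nat) : subseq (q1 ++ q2) s ->
  exists a b, [/\ s = a ++ b, subseq q1 a & subseq q2 b].
Proof.
elim: s q1 => [|x s IH] q1.
  by case: q1 q2 => [|//] [|//] _; exists [::], [::].
case: q1 => [|y q1] h; first by exists [::], (x :: s); rewrite sub0seq.
move: h => /=; case: eqP => [->|_] h.
  by have [a [b [-> h1 h2]]] := IH _ h; exists (x :: a), b; rewrite /= eqxx.
have [a [b [-> h1 h2]]] := IH (y :: q1) h; exists (x :: a), b; split=> //.
exact: subseq_trans h1 (subseq_cons _ _).
Qed.

Lemma subseq_cons_split x (q s : seq nat) : subseq (x :: q) s ->
  exists a b, s = a ++ x :: b /\ subseq q b.
Proof.
elim: s => //= y s IH; case: eqP => [->|_]; first by exists [::], s.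
by move/IH=> [a [b [-> h]]]; exists (y :: a), b.
Qed.

Lemma subseq_rcons_split x (q s : seq nat) : subseq (rcons q x) s ->
  exists a b, s = a ++ x :: b /\ subseq q a.
Proof.
rewrite -cats1 => /subseq_cat_split[a [b [-> h /subseq_cons_split[c [d [-> _]]]]]].
by exists (a ++ c), d; rewrite catA; split=> //; apply: subseq_trans h (prefix_subseq _ _).
Qed.

(** In a run, the second [y] of a subword [y z y z] with [y < z] removes [z] for good, so the last
    [z] would have to exceed every letter read before. Conversely, a letter that the machine rejects
    is an old one popped by a smaller [y], and [y] also occurs before it, which yields a
    crossing. *)
Lemma ncpP s : ncp s <-> is_part s /\ noncrossing s.
Proof.
split=> [h|[]].
  split.
    elim/last_ind: s h => // s x IH; rewrite -cats1 ncp_cat /= andbT cats1 is_part_rcons.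
    case/andP=> /IH ps hx; rewrite ps /=.
    case/orP: hx => [/mem_stk/= xs|/eqP->]; last by rewrite leqnn.
    by rewrite (is_part_pos ps xs) leqW // leq_nblocks.
  case/crossingP=> y [z [yz]] /(@subseq_cat_split [:: y; z] [:: y; z])[a [c [e ha]]].
  case/subseq_cons_split=> [b [d [ec zd]]]; move: h; rewrite e ec catA => h.
  have := ncp_new_after h yz; rewrite -sub1seq => /(_ zd); rewrite ltnNge leq_nblocks //.
  rewrite mem_cat -sub1seq; apply/orP; left; apply: subseq_trans ha.
  exact: subseq_cons.
elim/last_ind: s => // s x IH; rewrite is_part_rcons => /andP[ps hx] nc.
have ncs : noncrossing s by move: nc; rewrite -cats1; apply: noncrossing_prefix.
rewrite -cats1 ncp_cat (IH ps ncs) /= andbT.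
have [//|xS] := boolP (x \in stk [::] s); have [//|xM] := eqVneq x (nblocks s).+1.
have xs : x \in s by apply: is_part_mem => //; lia.
have [a [b [y [es yb yx]]]] := notin_stkP xs xS.
case: nc; apply/crossingP; exists y, x; split=> //.
(* The growth condition on the prefix ending in [x] forces the smaller letter [y] to occur already
   in [a]. *)
have pax : is_part (rcons a x).
  by move: ps; rewrite es -cat_rcons /is_part rgw_from_cat => /andP[].
have y0 : 0 < y by apply: is_part_pos ps _; rewrite es mem_cat inE yb !orbT.
have ya : y \in a.
  by move: pax; rewrite is_part_rcons => /andP[pa xa]; apply: is_part_mem => //; lia.
have h1 : subseq [:: y; x; y] s.
  have h2 : subseq [:: x; y] (x :: b) by rewrite /= eqxx sub1seq.
  by rewrite es; apply: (@cat_subseq _ [:: y] [:: x; y]) h2; rewrite sub1seq.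
by rewrite -cats1; apply: (@cat_subseq _ [:: y; x; y] [:: x]) h1 _; rewrite sub1seq inE.
Qed.

(** * Pattern containment *)

Lemma order_iso_map (psi : nat -> nat) q p :
  {in q &, forall x y, (psi x < psi y) = (x < y)} ->
  order_iso (map psi q) p <-> order_iso q p.
Proof.
move=> h; have nthE i j : i < size q -> j < size q ->
  (nth 0 (map psi q) i < nth 0 (map psi q) j) = (nth 0 q i < nth 0 q j).
  by move=> iq jq; rewrite !(nth_map 0) // h // mem_nth.
split=> -[sq e]; (split; first by rewrite -sq size_map) => i j iq jq.
  by have := e i j; rewrite size_map nthE // => ->.
by rewrite size_map in iq jq; rewrite nthE // e.
Qed.

Lemma contains_map (psi : nat -> nat) s p :
  {in s &, forall x y, (psi x < psi y) = (x < y)} ->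
  contains (map psi s) p <-> contains s p.
Proof.
move=> h; split=> [[m [sm e]]|[m [sm e]]]; exists m.
  rewrite size_map in sm; split=> //; move: e; rewrite -map_mask.
  by apply: (proj1 (order_iso_map _ _)) => x y /mem_mask xs /mem_mask; apply: h.
rewrite size_map; split=> //; rewrite -map_mask.
by apply/order_iso_map => // x y /mem_mask xs /mem_mask; apply: h.
Qed.

Lemma contains_shift k s p : contains (map (addn k) s) p <-> contains s p.
Proof. by apply: contains_map => x y _ _; rewrite ltn_add2l. Qed.

Lemma ltn_addr_false n i : (n + i < n) = false.
Proof. by rewrite ltnNge leq_addr. Qed.

(** Cut [q] at position [size a]. Positivity of [b] puts all its shifted letters strictly above
    [nblocks a], hence above the letters of [a]. *)
Lemma order_iso_bracket q a b : all (fun x => 0 < x) b ->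
  order_iso q (pbracket a b) <->
  exists q1 q2, [/\ q = q1 ++ q2, order_iso q1 a, order_iso q2 b
    & {in q1 & q2, forall x y, x < y}].
Proof.
move=> /allP b0; split=> [[sq e]|[q1 [q2 [-> [s1 e1] [s2 e2] lt]]]]; last first.
  split=> [|i j]; first by rewrite !size_cat size_map s1 s2.
  rewrite !size_cat !nth_cat s1 => iq jq.
  case: (ltnP i) => ia; case: (ltnP j) => ja.
  - by apply: e1; rewrite s1.
  - have j2 : j - size a < size q2 by lia.
    have jb : j - size a < size b by lia.
    have -> : nth 0 q1 i < nth 0 q2 (j - size a) by apply: lt; apply: mem_nth; rewrite ?s1.
    rewrite (nth_map 0); last by lia.
    symmetry; apply: leq_ltn_trans (leq_nblocks (mem_nth 0 ia)) _.
    by rewrite -[X in X < _]addn0 ltn_add2l b0 // mem_nth.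
  - have i2 : i - size a < size q2 by lia.
    have /ltnW : nth 0 q1 j < nth 0 q2 (i - size a) by apply: lt; apply: mem_nth; rewrite ?s1.
    rewrite leqNgt => /negbTE ->; rewrite (nth_map 0); last by lia.
    symmetry; apply/negbTE; rewrite -leqNgt.
    by apply: leq_trans (leq_nblocks (mem_nth 0 ja)) (leq_addr _ _).
  rewrite !(nth_map 0) ?ltn_add2l; try lia.
  by apply: e2; lia.
rewrite size_cat size_map in sq.
have qE := cat_take_drop (size a) q.
have s1 : size (take (size a) q) = size a by rewrite size_take; case: ltnP; lia.
have s2 : size (drop (size a) q) = size b by rewrite size_drop; lia.
exists (take (size a) q), (drop (size a) q); rewrite qE; split=> //.
- split=> // i j; rewrite s1 => ia ja; rewrite !nth_take // e; try lia.
  by rewrite !nth_cat ia ja.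
- split=> // i j; rewrite s2 => ib jb; rewrite !nth_drop e; try lia.
  by rewrite !nth_cat !ltn_addr_false !addKn !(nth_map 0) // ltn_add2l.
move=> x y /(nthP 0)[i + <-] /(nthP 0)[j + <-]; rewrite s1 s2 => ia jb.
rewrite nth_take // nth_drop e; try lia.
rewrite !nth_cat ia ltn_addr_false addKn (nth_map 0) //.
apply: leq_ltn_trans (leq_nblocks (mem_nth 0 ia)) _.
by rewrite -[X in X < _]addn0 ltn_add2l b0 // mem_nth.
Qed.

Lemma contains_bracket s a b : all (fun x => 0 < x) b ->
  contains s (pbracket a b) <->
  exists q1 q2, [/\ subseq (q1 ++ q2) s, order_iso q1 a, order_iso q2 b
    & {in q1 & q2, forall x y, x < y}].
Proof.
move=> b0; split=> [/containsP[q qs /order_iso_bracket[//|q1 [q2 [eq *]]]]|].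
  by exists q1, q2; rewrite -eq.
move=> [q1 [q2 [qs h1 h2 h]]]; apply/containsP; exists (q1 ++ q2) => //.
by apply/order_iso_bracket => //; exists q1, q2.
Qed.

(** * Interleaving old letters with components *)

(* A non-crossing partition is connected iff it ends in the block of its first letter. *)
Definition is_comp (C : seq nat) : bool := ncp C && (last 0 C == 1).

(* [None] stands for the next component from [cs], renumbered to start at [K.+1],
   and [Some o] for the old letter [o]. *)
Fixpoint build (K : nat) (l : seq (option nat)) (cs : seq (seq nat)) : seq nat :=
  match l, cs with
  | Some o :: l', _ => o :: build K l' cs
  | None :: l', C :: cs' => map (addn K) C ++ build (K + nblocks C) l' cs'
  | _, _ => [::]
  end.

Definition olds (l : seq (option nat)) : seq nat := pmap id l.

Definition slots (l : seq (option nat)) : nat := count (fun x => x == None) l.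

(* The components since the last old letter: these are the ones left on the stack. *)
Fixpoint top_comps (n : nat) (l : seq (option nat)) : nat :=
  match l with
  | Some _ :: l' => top_comps 0 l'
  | None :: l' => top_comps n.+1 l'
  | [::] => n
  end.

Definition assemble (K : nat) (cs : seq (seq nat)) : seq nat :=
  build K (nseq (size cs) None) cs.

Lemma push_map (psi : nat -> nat) S x :
  {in x :: S &, forall y z, (psi y < psi z) = (y < z)} ->
  push (map psi S) (psi x) = map psi (push S x).
Proof.
move=> h; rewrite /push map_rcons filter_map; congr (rcons (map _ _) _).
by apply: eq_in_filter => y yS /=; rewrite h ?inE ?yS ?eqxx ?orbT.
Qed.

Lemma push_cat T S K x : all (fun y => y <= K) T -> K < x -> push (T ++ S) x = T ++ push S x.
Proof.
move=> /allP TK Kx; rewrite /push filter_cat -rcons_cat; congr (rcons (_ ++ _) _).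
by apply/all_filterP/allP => y /TK yK; apply: leq_ltn_trans Kx.
Qed.

Lemma push_shift K S x : push (map (addn K) S) (K + x) = map (addn K) (push S x).
Proof. by apply: push_map => y z _ _; rewrite ltn_add2l. Qed.

(** Letters above [K] neither use nor pop the entries of [S], so a shifted word runs on top of [S]
    as it would alone. *)
Lemma ncp_from_shift K M S T s : all (fun y => y <= K) S -> all (fun x => 0 < x) s ->
  ncp_from (K + M) (S ++ map (addn K) T) (map (addn K) s) = ncp_from M T s /\
  stk (S ++ map (addn K) T) (map (addn K) s) = S ++ map (addn K) (stk T s).
Proof.
move=> SK; elim: s M T => //= x s IH M T /andP[x0 s0].
rewrite -addn_maxr (@push_cat _ _ K) //; last by lia.
rewrite push_shift mem_cat -addnS eqn_add2l mem_map; last exact: addnI.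
have [-> ->] := IH (maxn M x) (push T x) s0.
suff -> : K + x \in S = false by [].
by apply/negbTE/negP => /(allP SK); lia.
Qed.

Lemma push_filter_neq z S x : x != z ->
  push [seq y <- S | y != z] x = [seq y <- push S x | y != z].
Proof.
move=> xz; rewrite /push filter_rcons xz; congr rcons.
by rewrite -!filter_predI; apply: eq_filter => y /=; rewrite andbC.
Qed.

(** Used to forget the opening letter of a component once that letter no longer occurs. *)
Lemma ncp_from_filter_neq z M S s : z \notin s ->
  ncp_from M [seq y <- S | y != z] s = ncp_from M S s.
Proof.
elim: s M S => //= x s IH M S; rewrite inE negb_or eq_sym => /andP[xz zs].
by rewrite push_filter_neq // IH // mem_filter xz.
Qed.

(** The final 1 pops everything else, since all letters are positive. *)
Lemma stk_is_comp C : is_comp C -> stk [::] C = [:: 1].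
Proof.
case/andP; elim/last_ind: C => // C x _; rewrite last_rcons => h /eqP x1.
rewrite {}x1 in h *; rewrite -cats1 stk_cat /= /push.
have := ncp_pos h; rewrite all_rcons /= => /allP C0.
rewrite (_ : [seq y <- _ | y < 1] = [::]) //.
apply: filter_eq_nil => y /mem_stk /= /C0.
by rewrite -leqNgt.
Qed.

Lemma is_comp_pos C : is_comp C -> all (fun x => 0 < x) C.
Proof. by case/andP => /ncp_pos. Qed.

Lemma mem1_is_comp C : is_comp C -> 1 \in C.
Proof. by case/andP=> _; case: C => // x C /= /eqP <-; apply: mem_last. Qed.

Lemma is_comp_state K S C w : is_comp C -> all (fun y => y <= K) S ->
  ncp_from K S (map (addn K) C ++ w) = ncp_from (K + nblocks C) (rcons S K.+1) w /\
  stk S (map (addn K) C) = rcons S K.+1.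
Proof.
move=> cC SK; have [h1 h2] := ncp_from_shift 0 [::] SK (is_comp_pos cC).
rewrite /= cats0 addn0 in h1 h2.
have C0 : C != [::] by case/andP: cC => _; case: (C).
have e : stk S (map (addn K) C) = rcons S K.+1 by rewrite h2 stk_is_comp //= cats1 addn1.
split=> //; rewrite ncp_from_cat h1 e nblocks_addn //.
have -> : ncp_from 0 [::] C by case/andP: cC.
by rewrite (maxn_idPr (leq_addr _ _)).
Qed.

(** Invariant: [T] contains the old letters on the stack, [S] the opening letters of the components
    read since the last old letter. A component adds one entry to [S]; an old letter acts on [T] and
    empties [S]. Hence neither acceptance nor the final height depends on the shape of the
    components, only on their places in [l]. *)
Lemma build_state M K T S l cs :
  M <= K -> all (fun y => y <= M) T -> all (fun y => M < y <= K) S ->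
  all is_comp cs -> slots l = size cs -> all (fun y => y <= M) (olds l) ->
  ncp_from K (T ++ S) (build K l cs) = ncp_from M T (olds l) /\
  exists S', stk (T ++ S) (build K l cs) = stk T (olds l) ++ S' /\
    size S' = top_comps (size S) l.
Proof.
elim: l K T S cs => [|[o|] l IH] K T S cs MK TM SMK ccs sl oM.
- by split=> //=; exists S.
- rewrite /= in oM; case/andP: oM => oM1 oM2.
  have -> : build K (Some o :: l) cs = o :: build K l cs by [].
  rewrite /= -/(olds l) mem_cat.
  have -> : o \in S = false by apply/negbTE/negP => /(allP SMK); lia.
  have -> : push (T ++ S) o = push T o ++ [::].
    rewrite cats0 /push filter_cat -[RHS]cats0 -!cats1 -!catA; congr (_ ++ _).
    rewrite (_ : filter _ S = [::]) //; apply: filter_eq_nil => y /(allP SMK); rewrite -leqNgt; lia.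
  have pM : all (fun y => y <= M) (push T o).
    by apply/allP => y; rewrite mem_push => /orP[/eqP->//|/andP[_ /(allP TM)]].
  rewrite (maxn_idPl (leq_trans oM1 MK)) (maxn_idPl oM1).
  have [-> h2] := IH K (push T o) [::] cs MK pM isT ccs sl oM2.
  split=> //; rewrite orbF; case: (o \in T) => //=.
  have -> : (o == K.+1) = false by lia.
  by have -> : (o == M.+1) = false by lia.
case: cs ccs sl => // C cs /= /andP[cC ccs] [sl].
have TSK : all (fun y => y <= K) (T ++ S).
  apply/allP => y; rewrite mem_cat => /orP[/(allP TM)|/(allP SMK)]; lia.
have [-> e] := is_comp_state (build (K + nblocks C) l cs) cC TSK.
rewrite stk_cat e rcons_cat -(size_rcons S K.+1); apply: IH => //; first by lia.
have := leq_nblocks (mem1_is_comp cC) => C1.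
by rewrite all_rcons; apply/andP; split; [lia|apply/allP => y /(allP SMK); lia].
Qed.

Lemma last_occurrence (x : nat) s : x \in s -> exists a b, s = rcons a x ++ b /\ x \notin b.
Proof.
elim: s => // y s IH; rewrite inE; have [/IH[a [b [-> xb]]] _|xs] := boolP (x \in s).
  by exists (y :: a), b.
by rewrite orbF => /eqP <-; exists [::], s.
Qed.

Lemma last_occurrence_inj (x : nat) a b a' b' : rcons a x ++ b = rcons a' x ++ b' ->
  x \notin b -> x \notin b' -> rcons a x = rcons a' x /\ b = b'.
Proof.
move=> e xb xb'; have sz c d : x \notin d -> index x (rev (rcons c x ++ d)) = size d.
  by move=> xd; rewrite rev_cat rev_rcons index_cat mem_rev (negPf xd) /= eqxx size_rev addn0.
have sb : size b = size b' by rewrite -(sz a) // e sz.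
have : size (rcons a x ++ b) = size (rcons a' x ++ b') by rewrite e.
rewrite !size_cat sb => /addIn sa.
by move/eqP: e; rewrite eqseq_cat // => /andP[/eqP-> /eqP->].
Qed.

(** Read from the left: a letter on [T] is old, and any other first letter must be [K.+1] and opens
    a component, which extends to the last occurrence of that letter. The remainder is shorter and
    again runs from [T]. *)
Lemma build_exists M K T w : M <= K -> all (fun y => y <= M) T -> ncp_from K T w ->
  exists l cs, [/\ w = build K l cs, all is_comp cs, slots l = size cs
    & all (fun y => y <= M) (olds l)].
Proof.
have [n] := ubnP (size w); elim: n K T w => // n IH K T [|x w] sn MK TM.
  by exists [::], [::].
have [xT|xT] := boolP (x \in T).
  rewrite /= xT /= => h; have xM := allP TM _ xT.
  rewrite (maxn_idPl (leq_trans xM MK)) in h.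
  have pM : all (fun y => y <= M) (push T x).
    by apply/allP => y; rewrite mem_push => /orP[/eqP->//|/andP[_ /(allP TM)]].
  have [l [cs [-> h1 h2 h3]]] := IH K _ w sn MK pM h.
  by exists (Some x :: l), cs; split=> //=; rewrite xM.
move=> h; have xK : x = K.+1 by move: h; rewrite /= (negPf xT) /= => /andP[/eqP].
have [a [b [e xb]]] := last_occurrence (mem_head x w).
rewrite e in h.
have TK : all (fun y => y <= K) T by apply/allP => y /(allP TM) /leq_trans; apply.
(* A letter [y <= K] before the last [x] would pop [x = K.+1]; that last [x] would then have to
   exceed the [x] read first. *)
have DK : all (fun y => K < y) (rcons a x).
  rewrite all_rcons xK ltnSn; apply/allP => y ya; rewrite ltnNge; apply/negP => yK.
  case/splitPr: ya e h => a1 a2 e h.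
  rewrite -cats1 -!catA in h.
  have := ncp_from_new_after (z := x) h; rewrite xK ltnS yK mem_cat inE eqxx orbT.
  move/(_ isT isT); case: a1 e {h} => [|x1 a1] /= []; first by lia.
  by move=> <- _; lia.
pose C := map (subn^~ K) (rcons a x).
have CE : map (addn K) C = rcons a x.
  rewrite -map_comp -[RHS]map_id; apply/eq_in_map => y /(allP DK) /=; lia.
have cC : is_comp C.
  have Cpos : all (fun x => 0 < x) C.
    by apply/allP => _ /mapP[y /(allP DK) yK ->]; rewrite subn_gt0.
  have [h1 _] := ncp_from_shift 0 [::] TK Cpos.
  move: h; rewrite ncp_from_cat => /andP[h _].
  rewrite /is_comp /ncp -h1 /= cats0 addn0 CE h /C map_rcons last_rcons xK; lia.
move: h; rewrite -CE; have [-> _] := is_comp_state b cC TK => h.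
rewrite -xK -(ncp_from_filter_neq _ _ xb) filter_rcons eqxx /= in h.
have fT : [seq y <- T | y != x] = T.
  by apply/all_filterP/allP => y /(allP TK); lia.
rewrite fT in h.
have sb : size b < n.
  by move: sn; have := congr1 size e; rewrite size_cat size_rcons /=; lia.
have [l [cs [eb h1 h2 h3]]] := IH _ T b sb (leq_trans MK (leq_addr _ _)) TM h.
exists (None :: l), (C :: cs); split=> //=; first by rewrite e -CE eb.
  by rewrite cC.
by rewrite -h2.
Qed.

Lemma mem_build K l cs x : x \in build K l cs -> all is_comp cs ->
  (x \in olds l) || (K < x).
Proof.
elim: l K cs => // -[o|] l IH K cs.
  rewrite /= !inE -orbA => /orP[-> _ //|xb cc].
  by rewrite (IH _ _ xb cc) orbT.
case: cs => // C cs; rewrite /= mem_cat => /orP[/mapP[y yC ->]|xb] /andP[cC cc].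
  have y0 := allP (is_comp_pos cC) _ yC.
  by rewrite -[X in X < _]addn0 ltn_add2l y0 orbT.
case/orP: (IH _ _ xb cc) => [->//|].
by move/(leq_ltn_trans (leq_addr _ _)) ->; rewrite orbT.
Qed.

(** The first letter decides between an old letter, at most [M], and a component, which starts with
    [K.+1]. The component ends at the last [K.+1] of the word, because what follows it consists of
    old letters and letters beyond its own maximum. *)
Lemma build_inj M K l cs l' cs' : M <= K -> build K l cs = build K l' cs' ->
  all is_comp cs -> all is_comp cs' -> slots l = size cs -> slots l' = size cs' ->
  all (fun y => y <= M) (olds l) -> all (fun y => y <= M) (olds l') -> l = l' /\ cs = cs'.
Proof.
have head C r K0 : is_comp C -> exists r', map (addn K0) C ++ r = K0.+1 :: r'.
  case/andP; case: C => // x C /andP[/orP[//|/eqP->] _] _.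
  by rewrite /= addn1; eexists.
elim: l K cs l' cs' => [|[o|] l IH] K cs [|[o'|] l'] cs' MK //.
- by case: cs cs' => // -[].
- case: cs' => // C cs' /= e _ /andP[/(head C (build (K + nblocks C) l' cs') K)[r hr]].
  by rewrite -e in hr.
- move=> /= [-> e] cc cc' s s' /andP[_ o1] /andP[_ o2].
  by have [-> ->] := IH _ _ _ _ MK e cc cc' s s' o1 o2.
- case: cs' => // C cs' /= e _ /andP[/(head C (build (K + nblocks C) l' cs') K)[r hr] _].
  move=> _ _ /andP[oM _].
  by rewrite -e in hr; case: hr => ?; lia.
- case: cs => // C cs /= e /andP[/(head C (build (K + nblocks C) l cs) K)[r hr]].
  by rewrite e in hr.
- case: cs => // C cs /= e /andP[/(head C (build (K + nblocks C) l cs) K)[r hr] _].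
  move=> _ _ _ _ /andP[oM _].
  by rewrite e in hr; case: hr => ?; lia.
case: cs cs' => // C cs [//|C' cs'] /= e /andP[cC cc] /andP[cC' cc'] [s] [s'] o1 o2.
have Klast D : is_comp D -> exists a, map (addn K) D = rcons a K.+1.
  case/andP=> _; case/lastP: D => // D x; rewrite last_rcons => /eqP ->.
  by rewrite map_rcons addn1; eexists.
have nin D l0 cs0 : is_comp D -> all is_comp cs0 -> all (fun y => y <= M) (olds l0) ->
  K.+1 \notin build (K + nblocks D) l0 cs0.
  move=> cD cc0 o0; apply/negP => /mem_build/(_ cc0)/orP[/(allP o0)|]; first by lia.
  by have := leq_nblocks (mem1_is_comp cD); lia.
have [a ea] := Klast _ cC; have [a' ea'] := Klast _ cC'.
rewrite ea ea' in e.
have [e1 e2] := last_occurrence_inj e (nin _ _ _ cC cc o1) (nin _ _ _ cC' cc' o2).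
have eC : C = C' by apply: (inj_map (@addnI K)); rewrite ea ea'.
rewrite -eC in e2 *.
by have [-> ->] := IH _ _ _ _ (leq_trans MK (leq_addr _ _)) e2 cc cc' s s' o1 o2.
Qed.

Lemma slots_nseq n : slots (nseq n None) = n.
Proof. by rewrite /slots count_nseq mul1n. Qed.

Lemma olds_nseq n : olds (nseq n None) = [::].
Proof. by elim: n. Qed.

Lemma olds_nil l : olds l = [::] -> l = nseq (slots l) None.
Proof. by elim: l => // -[//|] l IH /= /IH {1}->. Qed.

Lemma top_comps_nseq n k : top_comps k (nseq n None) = k + n.
Proof. by elim: n k => [|n IH] k /=; rewrite ?addn0 // IH addSnnS. Qed.

Lemma size_build K l cs : slots l = size cs ->
  size (build K l cs) = size (olds l) + sumn (map size cs).
Proof.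
elim: l K cs => [|[o|] l IH] K cs; first by case: cs.
  by move=> h; rewrite /= IH.
by case: cs => // C cs [h]; rewrite /= size_cat size_map IH // addnCA.
Qed.

Lemma size_assemble K cs : size (assemble K cs) = sumn (map size cs).
Proof. by rewrite size_build ?slots_nseq // olds_nseq. Qed.

Lemma filter_build M K l cs : M <= K -> all is_comp cs -> slots l = size cs ->
  all (fun y => y <= M) (olds l) -> [seq y <- build K l cs | M < y] = assemble K cs.
Proof.
elim: l K cs => [|[o|] l IH] K cs MK; first by case: cs.
  by move=> /= h1 h2 /andP[oM h3]; rewrite ltnNge oM /= IH.
case: cs => // C cs /= /andP[cC cc] [s] h.
rewrite /assemble /= filter_cat IH //; last exact: leq_trans MK (leq_addr _ _).
congr (_ ++ _); apply/all_filterP/allP => _ /mapP[y /(allP (is_comp_pos cC)) y0 ->]; lia.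
Qed.

Lemma assemble_shift K j cs : assemble (K + j) cs = map (addn K) (assemble j cs).
Proof.
elim: cs j => // C cs IH j; rewrite /assemble /= map_cat -/(assemble _ _) -map_comp.
rewrite -addnA -/(assemble _ _) IH; congr (_ ++ _).
by apply: eq_map => x /=; rewrite addnA.
Qed.

Lemma ncp_assemble cs : all is_comp cs ->
  ncp (assemble 0 cs) /\ ncomp (assemble 0 cs) = size cs.
Proof.
move=> cc; have := @build_state 0 0 [::] [::] (nseq (size cs) None) cs.
rewrite slots_nseq olds_nseq top_comps_nseq => -[] // h [S' [e s]].
by split=> //; rewrite /ncomp e.
Qed.

(** Apply [build_exists] to the empty stack with [M = 0]. An old letter would be at most 0, whereas
    the first letter accepted from the empty stack is 1. *)
Lemma ncp_assembleP p : ncp p -> exists2 cs, all is_comp cs & p = assemble 0 cs.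
Proof.
move=> h; have [l [cs [e cc s o]]] := build_exists (M := 0) (leqnn 0) (isT : all _ [::]) h.
exists cs => //; rewrite /assemble -s -olds_nil //.
have [h1 _] := @build_state 0 0 [::] [::] l cs isT isT isT cc s o.
move: h; rewrite e /ncp h1; case: (olds l) o => // x t /= /andP[x0 _] /andP[/eqP x1].
by rewrite x1 in x0.
Qed.

(** * Numbers of components *)

Lemma foldl_pbracket p cs : foldl pbracket p cs = p ++ assemble (nblocks p) cs.
Proof.
elim: cs p => [|C cs IH] p /=; first by rewrite cats0.
rewrite IH /pbracket -catA nblocks_cat /assemble /=; congr (_ ++ (_ ++ build _ _ _)).
have [->|C0] := eqVneq C [::]; first by rewrite /= maxn0 addn0.
by rewrite nblocks_addn // (maxn_idPr (leq_addr _ _)).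
Qed.

Lemma assemble_cons C cs : assemble 0 (C :: cs) = pbracket C (assemble 0 cs).
Proof.
rewrite /pbracket -assemble_shift addn0 {1}/assemble /= add0n.
by congr (_ ++ _); rewrite -[RHS]map_id; apply: eq_map.
Qed.

Lemma assemble_inj cs cs' : all is_comp cs -> all is_comp cs' ->
  assemble 0 cs = assemble 0 cs' -> cs = cs'.
Proof.
move=> cc cc' e; have o n : all (fun y => y <= 0) (olds (nseq n None)) by rewrite olds_nseq.
by have [_] := build_inj (leqnn 0) e cc cc' (slots_nseq _) (slots_nseq _) (o _) (o _).
Qed.

Lemma subseq_assemble C cs K : C \in cs ->
  exists k, subseq (map (addn k) C) (assemble K cs).
Proof.
elim: cs K => // D cs IH K; rewrite inE => /orP[/eqP->|/(IH (K + nblocks D))[k h]].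
  by exists K; rewrite /assemble /=; apply: prefix_subseq.
by exists k; rewrite /assemble /=; apply: subseq_trans h (suffix_subseq _ _).
Qed.

(** The last letter of [a[b]] with both parts nonempty is at least 2. *)
Lemma is_comp_connected C : is_comp C -> connected C.
Proof.
case/andP=> _ /eqP l1 [a [b [pa pb a0 b0 e]]].
case/lastP: b b0 pb e => // b x _ pb e.
have x0 : 0 < x by apply: is_part_pos pb _; rewrite mem_rcons mem_head.
move: l1; rewrite e /pbracket map_rcons last_cat last_rcons.
case: a a0 pa {e} => // y a _ pa.
have y0 : 0 < y by apply: is_part_pos pa _; rewrite mem_head.
by move: (nblocks _) (leq_nblocks (mem_head y a)) => k yk ks; lia.
Qed.

Lemma connected_is_comp C : ncp C -> C <> [::] -> connected C -> is_comp C.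
Proof.
move=> /ncp_assembleP[[|D [|E cs]] cc ->] // _.
  move=> _; rewrite assemble_cons /pbracket /assemble /= cats0.
  by case/andP: cc.
case; exists D, (assemble 0 (E :: cs)); rewrite -assemble_cons.
have cD : is_comp D by case/andP: cc.
have cc' : all is_comp (E :: cs) by case/andP: cc.
have [hD _] := proj1 (ncpP _) (proj1 (andP cD)).
have [h _] := proj1 (ncpP _) (proj1 (ncp_assemble cc')).
split=> //; first by move=> D0; rewrite D0 in cD.
case/andP: cc' => cE _; rewrite assemble_cons /pbracket.
by case: E cE {h cc} => // x E _.
Qed.

(** Each connected part occurs in [p] as a shifted subword, so it inherits non-crossingness and is
    an [is_comp]; [ncp_assemble] then counts the parts by the stack height. *)
Lemma has_ncompP p m : ncp p -> has_ncomp p m <-> m = ncomp p.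
Proof.
move=> hp; split=> [[cs [<- h]]|->].
  rewrite foldl_pbracket /= => e; have [_ nc] := proj1 (ncpP p) hp.
  rewrite e; symmetry; apply: (proj2 (ncp_assemble _)).
  apply/allP => C Cs; have [pC C0 cC] := h C Cs; apply: connected_is_comp => //.
  apply/ncpP; split=> // hC; apply: nc; rewrite e.
  have [k /contains_subseq] := subseq_assemble 0 Cs; apply.
  exact/contains_shift.
have [cs cc e] := ncp_assembleP hp; exists cs; split.
- by rewrite e (proj2 (ncp_assemble cc)).
- move=> C /(allP cc) cC; split; last exact: is_comp_connected.
    by have [] := proj1 (ncpP C) (proj1 (andP cC)).
  by move=> C0; rewrite C0 in cC.
by rewrite foldl_pbracket.
Qed.

(** * Transferring cc-equivalence through a context *)

Definition av_part (r p : seq nat) : Prop := ncp p /\ avoids p r.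

(** A size- and component-preserving bijection as a relation on bare words. It can be defined by
    cases without handling the proofs stored in [Av]; functions are recovered by choice in
    [cc_rel_fun]. *)
Definition cc_rel (r r' : seq nat) (R : seq nat -> seq nat -> Prop) : Prop :=
  [/\ forall x, av_part r x -> exists y, R x y,
      forall y, av_part r' y -> exists x, R x y,
      forall x y, R x y ->
        [/\ av_part r x, av_part r' y, size x = size y & ncomp x = ncomp y],
      forall x y y', R x y -> R x y' -> y = y'
    & forall x x' y, R x y -> R x' y -> x = x'].

Lemma Av_inj r (a b : Av r) : proj1_sig a = proj1_sig b -> a = b.
Proof.
by case: a b => [a ha] [b hb] /= e; subst b; congr exist; apply: proof_irrelevance.
Qed.

Lemma Av_part r p : av_part r p <-> [/\ is_part p, noncrossing p & avoids p r].
Proof. by split=> [[/ncpP[]]|[h1 h2 h3]] //; split=> //; apply/ncpP. Qed.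

Lemma cc_rel_sym r r' R : cc_rel r r' R -> cc_rel r' r (fun x y => R y x).
Proof.
by case=> h1 h2 h3 h4 h5; split=> // [x y /h3[]//|x y y' |x x' y]; [apply: h5|apply: h4].
Qed.

Lemma cc_rel_fun r r' R : cc_rel r r' R ->
  exists f : Av r -> Av r', forall x, R (proj1_sig x) (proj1_sig (f x)).
Proof.
case=> h1 _ h3 _ _.
have H (x : Av r) : exists y : Av r', R (proj1_sig x) (proj1_sig y).
  have [y Rxy] := h1 _ (proj2 (Av_part r _) (proj2_sig x)).
  have [_ hy _ _] := h3 _ _ Rxy.
  by exists (exist _ y (proj1 (Av_part _ _) hy)).
exists (fun x => proj1_sig (constructive_indefinite_description _ (H x))) => x.
exact: proj2_sig (constructive_indefinite_description _ (H x)).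
Qed.

Lemma cc_equivP r r' : cc_equiv r r' <-> exists R, cc_rel r r' R.
Proof.
have ncpA s (x : Av s) : ncp (proj1_sig x).
  by have [] := proj2 (Av_part s _) (proj2_sig x).
split=> [[f [[g fK gK] hs hn]]|[R hR]].
  exists (fun x y => exists2 a : Av r, proj1_sig a = x & proj1_sig (f a) = y); split.
  - by move=> x /Av_part hx; exists (proj1_sig (f (exist _ x hx))), (exist _ x hx).
  - move=> y /Av_part hy; exists (proj1_sig (g (exist _ y hy))), (g (exist _ y hy)) => //.
    by rewrite gK.
  - move=> _ _ [a <- <-]; split; [exact/Av_part/(proj2_sig a)|exact/Av_part/(proj2_sig (f a))| |].
      by rewrite hs.
    by apply/has_ncompP => //; apply/hn; apply/has_ncompP.
  - by move=> x _ _ [a <- <-] [b /Av_inj -> <-].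
  - by move=> _ _ y [a <- <-] [b <- /Av_inj/(can_inj fK) ->].
have [f hf] := cc_rel_fun hR; have [g hg] := cc_rel_fun (cc_rel_sym hR).
have [_ _ h3 h4 h5] := hR.
exists f; split.
- by exists g => x; apply: Av_inj; [apply: h5 (hg _) (hf _)|apply: h4 (hf _) (hg _)].
- by move=> x; have [_ _ ->] := h3 _ _ (hf x).
- by move=> x m; have [_ _ _ e] := h3 _ _ (hf x); rewrite !has_ncompP // e.
Qed.

(* [D p c q]: the partition [p] is obtained by plugging the partition [q] into the
   context [c]; which [q] fit into [c] depends on the number of components only. *)
Lemma cc_equiv_context (ctx : Type) (D : seq nat -> ctx -> seq nat -> Prop)
    (pat : seq nat -> seq nat) (r r' : seq nat) :
  (forall p c q, D p c q -> ncp p /\ ncp q) ->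
  (forall p c q c' q', D p c q -> D p c' q' -> c = c' /\ q = q') ->
  (forall p p' c q, D p c q -> D p' c q -> p = p') ->
  (forall p c q q', D p c q -> ncp q' -> ncomp q' = ncomp q -> exists p', D p' c q') ->
  (forall p p' c q q', D p c q -> D p' c q' -> size q = size q' -> ncomp q = ncomp q' ->
    size p = size p' /\ ncomp p = ncomp p') ->
  (forall s p c q, s = r \/ s = r' -> D p c q -> contains p (pat s) <-> contains q s) ->
  (forall s p, s = r \/ s = r' -> ncp p -> (forall c q, ~ D p c q) -> avoids p (pat s)) ->
  cc_equiv r r' -> cc_equiv (pat r) (pat r').
Proof.
move=> Dn Dl Dr De Ds Dc Dt /cc_equivP[R0 [t0 s0 st0 f0 i0]]; apply/cc_equivP.
(* A partition that fits no context is fixed; otherwise the context is kept and the plugged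
   partition is replaced along [R0]. *)
exists (fun p p' => (av_part (pat r) p /\ p = p' /\ forall c q, ~ D p c q) \/
  exists c q q', [/\ D p c q, D p' c q' & R0 q q']).
split.
- move=> x hx; have [[c [q Dq]]|nD] := classic (exists c q, D x c q).
    have [_ hq] := Dn _ _ _ Dq.
    have aq : av_part r q.
      by split=> // /(Dc r _ _ _ (or_introl erefl) Dq); apply: (proj2 hx).
    have [q' Rq] := t0 q aq; have [_ [hq' _] _ e] := st0 _ _ Rq.
    have [x' Dx'] := De _ _ _ q' Dq hq' (esym e).
    by exists x'; right; exists c, q, q'.
  by exists x; left; do 2!split=> //; move=> c q Dq; apply: nD; exists c, q.
- move=> x hx; have [[c [q' Dq]]|nD] := classic (exists c q, D x c q).
    have [_ hq] := Dn _ _ _ Dq.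
    have aq : av_part r' q'.
      by split=> // /(Dc r' _ _ _ (or_intror erefl) Dq); apply: (proj2 hx).
    have [q Rq] := s0 q' aq; have [[hq' _] _ _ e] := st0 _ _ Rq.
    have [x' Dx'] := De _ _ _ q Dq hq' e.
    by exists x'; right; exists c, q, q'.
  have nD' c q : ~ D x c q by move=> Dq; apply: nD; exists c, q.
  exists x; left; split=> //; split; first by case: hx.
  by apply: Dt => //; [left | case: hx].
- move=> x y [[hx [<- nD]]|[c [q [q' [Dq Dq' Rq]]]]].
    by split=> //; split; [case: hx | apply: Dt nD => //; [right|case: hx]].
  have [[_ aq] [_ aq'] sz nc] := st0 _ _ Rq.
  have [-> ->] := Ds _ _ _ _ _ Dq Dq' sz nc.
  split=> //; (split; first by case: (Dn _ _ _ Dq); case: (Dn _ _ _ Dq')).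
    by move/(Dc r _ _ _ (or_introl erefl) Dq).
  by move/(Dc r' _ _ _ (or_intror erefl) Dq').
- move=> x y y' [[_ [<- nD]]|[c [q [q' [Dq Dq' Rq]]]]]
    [[_ [<- nD2]]|[c2 [q2 [q2' [Dq2 Dq2' Rq2]]]]] //.
  + by case: (nD _ _ Dq2).
  + by case: (nD2 _ _ Dq).
  have [ec eq] := Dl _ _ _ _ _ Dq Dq2; subst c2 q2.
  rewrite (f0 _ _ _ Rq Rq2) in Dq'; exact: Dr Dq' Dq2'.
move=> x x' y [[_ [-> nD]]|[c [q [q' [Dq Dq' Rq]]]]] [[_ [e nD2]]|[c2 [q2 [q2' [Dq2 Dq2' Rq2]]]]].
- by [].
- by case: (nD _ _ Dq2').
- by subst y; case: (nD2 _ _ Dq').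
have [ec eq] := Dl _ _ _ _ _ Dq' Dq2'; subst c2 q2'.
rewrite (i0 _ _ _ Rq Rq2) in Dq; exact: Dr Dq Dq2.
Qed.

(** * Prefix contexts *)

Lemma ex_least (P : nat -> Prop) : (exists n, P n) ->
  exists n, P n /\ forall m, m < n -> ~ P m.
Proof.
case=> n; elim/ltn_ind: n => n IH Pn.
have [[m [mn Pm]]|h] := classic (exists m, m < n /\ P m); first exact: IH Pm.
by exists n; split=> // m mn Pm; apply: h; exists m.
Qed.

Lemma contains_bracketl s a b : contains s (pbracket a b) -> contains s a.
Proof.
rewrite /pbracket => /containsP[q qs [sq e]]; apply/containsP.
rewrite size_cat size_map in sq.
exists (take (size a) q); first exact: subseq_trans (take_subseq _ _) qs.
have s1 : size (take (size a) q) = size a by rewrite size_takel // sq leq_addr.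
split=> // i j; rewrite s1 => ia ja; rewrite !nth_take // e; try lia.
by rewrite !nth_cat ia ja.
Qed.

Lemma contains_bracketr s a b : all (fun x => 0 < x) b ->
  contains s (pbracket a b) -> contains s b.
Proof.
move=> b0 /contains_bracket-/(_ b0)[q1 [q2 [qs _ h _]]]; apply/containsP; exists q2 => //.
exact: subseq_trans (suffix_subseq _ _) qs.
Qed.

Lemma cat_prefix (u v w w' : seq nat) : u ++ w = v ++ w' -> size u <= size v ->
  exists2 d, v = u ++ d & w = d ++ w'.
Proof.
move=> e uv; have eu : v = u ++ drop (size u) v.
  have := congr1 (take (size u)) e; rewrite take_cat ltnn subnn take0 cats0 takel_cat //.
  by move=> {1}->; rewrite cat_take_drop.
exists (drop (size u) v) => //; move: e; rewrite {1}eu -catA => /eqP.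
by rewrite eqseq_cat // eqxx => /eqP.
Qed.

(** The context is a pair: the shortest prefix containing [sigma], and the pattern of old letters
    and component slots after it. Legality is required of the old letters alone, so any partition
    with the right number of components fits. *)
Definition prefix_dec (sigma p : seq nat) (c : seq nat * seq (option nat))
    (q : seq nat) : Prop :=
  let M := nblocks c.1 in
  exists cs, [/\ [/\ all is_comp cs, slots c.2 = size cs, all (fun y => y <= M) (olds c.2)
                   & ncp_from M (stk [::] c.1) (olds c.2)],
                 p = c.1 ++ build M c.2 cs, q = assemble 0 cs
               & [/\ ncp c.1, contains c.1 sigma
                   & forall i, i < size c.1 -> ~ contains (take i c.1) sigma]].

Lemma prefix_dec_ncp sigma p c q : prefix_dec sigma p c q ->
  [/\ ncp p, ncp q & ncomp p = size (stk (stk [::] c.1) (olds c.2)) + top_comps 0 c.2].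
Proof.
move=> [cs [[cc sl oM on] -> -> [nu _ _]]].
have [h1 [S' [e s']]] := @build_state _ _ _ [::] _ _ (leqnn _) (stk_leq c.1) isT cc sl oM.
rewrite cats0 in h1 e.
split; last by rewrite /ncomp stk_cat e size_cat s'.
  by rewrite ncp_cat nu h1.
exact: (proj1 (ncp_assemble cc)).
Qed.

Lemma prefix_dec_exists sigma p : ncp p -> contains p sigma -> exists c q, prefix_dec sigma p c q.
Proof.
move=> hp hc; have [|i [ci mi]] := @ex_least (fun i => contains (take i p) sigma).
  by exists (size p); rewrite take_size.
have ip : i <= size p.
  by rewrite leqNgt; apply/negP => /mi; rewrite take_size.
move: (hp); rewrite -{1}(cat_take_drop i p) ncp_cat => /andP[nu nw].
have [l [cs [e cc sl oM]]] := build_exists (leqnn _) (stk_leq _) nw.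
exists (take i p, l), (assemble 0 cs), cs; split=> //=; last first.
- split=> // j; rewrite size_take_min => jm; rewrite take_takel; last by lia.
  by apply: mi; lia.
- by rewrite -e cat_take_drop.
split=> //; have [h1 _] := @build_state _ _ _ [::] _ _ (leqnn _) (stk_leq (take i p)) isT cc sl oM.
by rewrite cats0 in h1; rewrite -h1 -e.
Qed.

(** Let [y] be the last letter of a copy of [sigma]. The letters of the copy of [s] come after [y]
    and exceed it, so by [ncp_new_after] they exceed everything read up to [y], in particular the
    maximum of [c.1]. Conversely, letters beyond that maximum extend any copy of [sigma] inside
    [c.1]. *)
Lemma prefix_dec_contains sigma s p c q :
  sigma != [::] -> all (fun x => 0 < x) s -> prefix_dec sigma p c q ->
  contains p (pbracket sigma s) <-> contains q s.
Proof.
move=> sigma0 s0 D; have [np _ _] := prefix_dec_ncp D.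
move: D => [cs [[cc sl oM on] ep eq [nu cu mu]]].
have fE : [seq y <- build (nblocks c.1) c.2 cs | nblocks c.1 < y] = map (addn (nblocks c.1)) q.
  by rewrite (filter_build (leqnn _) cc sl oM) eq -assemble_shift addn0.
rewrite contains_bracket //; split.
  move=> [q1 [q2 [qs h1 h2 h]]].
  have [a' [b [eab s1 s2]]] := subseq_cat_split qs.
  case/lastP: q1 h1 s1 h {qs} => [[sz _]|q1 y h1 s1 h].
    by case: (sigma) sigma0 sz.
  have [a [a2 [ea sa]]] := subseq_rcons_split s1.
  move: eab; rewrite ea -catA cat_cons => eab.
  (* Otherwise a proper prefix of [c.1] would contain [sigma]. *)
  have ua : size c.1 <= size (rcons a y).
    rewrite leqNgt; apply/negP => lt; case: (mu _ lt).
    have [||d ed _] := @cat_prefix (rcons a y) c.1 (a2 ++ b) (build (nblocks c.1) c.2 cs).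
    - by rewrite -ep cat_rcons eab.
    - exact: ltnW.
    rewrite ed take_size_cat //.
    apply/containsP; exists (rcons q1 y) => //.
    by rewrite -!cats1; apply: cat_subseq => //; rewrite eqxx.
  apply/(contains_shift (nblocks c.1)); rewrite -fE; apply/containsP; exists q2 => //.
  have [|//|d ed ew] := @cat_prefix c.1 (rcons a y) (build (nblocks c.1) c.2 cs) (a2 ++ b).
    by rewrite -ep cat_rcons eab.
  rewrite ew filter_cat; apply: subseq_trans (suffix_subseq _ _).
  rewrite filter_cat; apply: subseq_trans (suffix_subseq _ _).
  rewrite subseq_filter s2 andbT; apply/allP => z zq.
  have yz : y < z by apply: h zq; rewrite mem_rcons mem_head.
  have za : nblocks a < z.
    apply: (@ncp_new_after a y (a2 ++ b)); rewrite -?eab // mem_cat.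
    by rewrite (mem_subseq s2 zq) orbT.
  apply: (@leq_ltn_trans (nblocks (rcons a y))).
    by rewrite ed nblocks_cat leq_maxl.
  by rewrite -cats1 nblocks_cat /= maxn0 gtn_max za.
move=> /(contains_shift (nblocks c.1)); rewrite -fE => /containsP[q2 h2 o2].
have /containsP[q1 h1 o1] := cu.
exists q1, q2; split=> //.
  by rewrite ep cat_subseq //; apply: subseq_trans h2 (filter_subseq _ _).
move=> x y /(mem_subseq h1)/leq_nblocks xM /(mem_subseq h2).
by rewrite mem_filter => /andP[yM _]; apply: leq_ltn_trans yM.
Qed.

Lemma prefix_dec_inj sigma p c q c' q' :
  prefix_dec sigma p c q -> prefix_dec sigma p c' q' -> c = c' /\ q = q'.
Proof.
move=> [cs [[cc sl oM _] ep -> [_ cu mu]]] [cs' [[cc' sl' oM' _] ep' -> [_ cu' mu']]].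
have pre (u v w w' : seq nat) : u ++ w = v ++ w' -> contains u sigma ->
    (forall i, i < size v -> ~ contains (take i v) sigma) -> size v <= size u.
  move=> e hu hv; rewrite leqNgt; apply/negP => lt; apply: (hv _ lt).
  by have [d -> _] := cat_prefix e (ltnW lt); rewrite take_size_cat.
have e : c.1 ++ build (nblocks c.1) c.2 cs = c'.1 ++ build (nblocks c'.1) c'.2 cs'.
  by rewrite -ep.
have su : size c.1 = size c'.1.
  by apply/eqP; rewrite eqn_leq (pre _ _ _ _ e cu mu') (pre _ _ _ _ (esym e) cu' mu).
move/eqP: e; rewrite eqseq_cat // => /andP[/eqP eu /eqP ew].
move: eu ew oM oM' sl sl' {su ep ep' cu mu cu' mu'}.
case: c c' => u l [u' l'] /= <- ew oM oM' sl sl'.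
by have [-> ->] := build_inj (leqnn _) ew cc cc' sl sl' oM oM'.
Qed.

Lemma cc_equiv_prefix sigma r r' : sigma != [::] -> is_part r -> is_part r' -> cc_equiv r r' ->
  cc_equiv (pbracket sigma r) (pbracket sigma r').
Proof.
move=> sigma0 pr pr'; have rpos s : s = r \/ s = r' -> all (fun x => 0 < x) s.
  by move=> h; apply/allP => x; apply: is_part_pos; case: h => ->.
apply: (@cc_equiv_context _ (prefix_dec sigma) (pbracket sigma)).
- by move=> p c q /prefix_dec_ncp[].
- exact: prefix_dec_inj.
- move=> p p' c q [cs [[cc sl oM on] -> -> _]] [cs' [[cc' sl' oM' on'] -> e _]].
  by rewrite (assemble_inj cc cc' e).
- move=> p c q q' [cs [[cc sl oM on] _ -> hu]] /ncp_assembleP[cs' cc' ->].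
  (* Equal component counts mean that the components of [q'] fill exactly the slots of [c.2]. *)
  rewrite !(proj2 (ncp_assemble _)) // => sz.
  by exists (c.1 ++ build (nblocks c.1) c.2 cs'), cs'; rewrite sz.
- move=> p p' c q q' D D'.
  have [_ _ ->] := prefix_dec_ncp D; have [_ _ ->] := prefix_dec_ncp D'.
  case: D => [cs [[_ sl _ _] -> -> _]]; case: D' => [cs' [[_ sl' _ _] -> -> _]].
  by rewrite !size_assemble !size_cat !size_build // => ->.
- by move=> s p c q /rpos; apply: prefix_dec_contains.
move=> s p _ np nD /contains_bracketl/(prefix_dec_exists np)[c [q D]].
exact: nD D.
Qed.

(** * Suffix contexts *)

(* A continuation of a partition with stack [S] and maximum [M] is coded as a
   continuation of [12...n], [n = size S], the partition into singletons that has
   the same stack height. *)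
Definition plug (M : nat) (S : seq nat) (j : nat) : nat :=
  if j <= size S then nth 0 S j.-1 else j - size S + M.

Definition unplug (M : nat) (S : seq nat) (y : nat) : nat :=
  if y <= M then (index y S).+1 else y - M + size S.

Lemma plug_gt M S j : size S < j -> plug M S j = j - size S + M.
Proof. by move=> jS; rewrite /plug leqNgt jS. Qed.

Lemma plug_leq M S j d : all (fun y => y <= M) S -> 0 < j <= size S + d -> plug M S j <= M + d.
Proof.
move=> SM /andP[j0 jS]; have [jS'|/plug_gt ->] := leqP j (size S); last by lia.
rewrite /plug jS'; apply: leq_trans (leq_addr _ _); apply: (allP SM).
by rewrite mem_nth // prednK.
Qed.

(** [S] is increasing and bounded by [M], and new letters land above [M]. This monotonicity carries
    both the stack dynamics and pattern containment through the coding. *)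
Lemma plug_ltn M S a b : all (fun y => y <= M) S -> sorted ltn S -> 0 < a -> 0 < b ->
  (plug M S a < plug M S b) = (a < b).
Proof.
move=> SM sS.
have homo x y : 0 < x -> x < y -> plug M S x < plug M S y.
  move=> x0 xy; have y0 : 0 < y by apply: ltn_trans xy.
  have [yS|yS] := leqP y (size S); last first.
    rewrite (plug_gt _ yS); have [xS|xS] := leqP x (size S).
      by have := @plug_leq M S x 0 SM; rewrite !addn0 x0 xS => /(_ isT); lia.
    by rewrite plug_gt //; lia.
  rewrite /plug yS (leq_trans (ltnW xy) yS).
  by apply: (sorted_ltn_nth ltn_trans) => //; rewrite ?inE; lia.
move=> a0 b0; case: (ltngtP a b) => [ab|ba|->]; last by rewrite ltnn.
  exact: homo.
by apply/negbTE; rewrite -leqNgt ltnW // homo.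
Qed.

Lemma plugK M S j : all (fun y => y <= M) S -> sorted ltn S -> 0 < j ->
  unplug M S (plug M S j) = j.
Proof.
move=> SM sS j0; have [jS|jS] := leqP j (size S).
  have := @plug_leq M S j 0 SM; rewrite !addn0 j0 jS => /(_ isT) pM.
  rewrite /unplug pM /plug jS index_uniq ?prednK //.
  exact: sorted_uniq ltn_trans ltnn _ sS.
rewrite plug_gt // /unplug.
have -> : (j - size S + M <= M) = false by lia.
by lia.
Qed.

Lemma unplugK M (S : seq nat) (y : nat) : (y \in S) || (M < y) -> all (fun y => y <= M) S ->
  plug M S (unplug M S y) = y.
Proof.
move=> h SM; have [yM|yM] := leqP y M.
  have yS : y \in S by move: h; rewrite ltnNge yM orbF.
  by rewrite /unplug yM /plug /= index_mem yS nth_index.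
have -> : unplug M S y = y - M + size S by rewrite /unplug leqNgt yM.
by rewrite plug_gt; lia.
Qed.

Lemma map_plug_iota M S : map (plug M S) (iota 1 (size S)) = S.
Proof.
rewrite -[1]/(1 + 0) iotaDl -map_comp -[RHS](mkseq_nth 0); apply/eq_in_map => i.
by rewrite mem_iota /plug /= => ->.
Qed.

Lemma stk_plug M S T c : all (fun y => y <= M) S -> sorted ltn S ->
  all (fun y => 0 < y) T -> all (fun y => 0 < y) c ->
  stk (map (plug M S) T) (map (plug M S) c) = map (plug M S) (stk T c).
Proof.
move=> SM sS; elim: c T => //= x c IH T T0 /andP[x0 c0].
rewrite push_map; last first.
  by move=> y z yT zT; rewrite plug_ltn //; [move: yT|move: zT];
    rewrite inE => /orP[/eqP->//|/(allP T0)].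
by apply: IH => //; apply/allP => y; rewrite mem_push => /orP[/eqP->|/andP[_ /(allP T0)]].
Qed.

(** Here [d] counts the new letters opened so far; the two runs have maxima [M + d] and [size S + d]
    and corresponding stacks. *)
Lemma ncp_from_plug M S d T c : all (fun y => y <= M) S -> sorted ltn S ->
  all (fun y => 0 < y <= size S + d) T -> all (fun y => 0 < y) c ->
  ncp_from (M + d) (map (plug M S) T) (map (plug M S) c) = ncp_from (size S + d) T c.
Proof.
move=> SM sS; elim: c d T => //= x c IH d T TP /andP[x0 c0].
have inj y z : 0 < y -> 0 < z -> (plug M S y == plug M S z) = (y == z).
  move=> y0 z0; case: (ltngtP y z) => [h|h|->]; last exact: eqxx.
    by rewrite ltn_eqF // plug_ltn.
  by rewrite gtn_eqF // plug_ltn.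
have -> : (plug M S x == (M + d).+1) = (x == (size S + d).+1).
  have -> : (M + d).+1 = plug M S (size S + d).+1 by rewrite plug_gt; lia.
  exact: inj.
have -> : (plug M S x \in map (plug M S) T) = (x \in T).
  apply/mapP/idP => [[y yT /eqP]|xT]; last by exists x.
  by rewrite inj //; [move/eqP-> | case/andP: (allP TP _ yT)].
rewrite push_map; last first.
  move=> y z yT zT; have pos u : u \in x :: T -> 0 < u.
    by rewrite inE => /orP[/eqP->//|/(allP TP)/andP[]].
  by rewrite plug_ltn // pos.
have pT e : x <= size S + e -> d <= e -> all (fun y => 0 < y <= size S + e) (push T x).
  move=> xe de; apply/allP => y; rewrite mem_push => /orP[/eqP->|/andP[_ /(allP TP)]].
    by rewrite x0.
  lia.
have [xE|xN] := eqVneq x (size S + d).+1.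
  have [-> ->] : maxn (M + d) (plug M S x) = M + d.+1 /\ maxn (size S + d) x = size S + d.+1.
    by rewrite plug_gt; lia.
  have xd : x <= size S + d.+1 by lia.
  by rewrite (IH d.+1 (push T x) (pT _ xd (leqnSn d)) c0).
rewrite orbF; have [xT|//] /= := boolP (x \in T).
have xd := allP TP _ xT.
rewrite (maxn_idPl (plug_leq SM xd)); case/andP: xd => _ xd; rewrite (maxn_idPl xd).
exact: IH d (push T x) (pT _ xd (leqnn d)) c0.
Qed.

Lemma filter_plug M S i c : all (fun y => y <= M) S -> all (fun y => 0 < y) c ->
  [seq y <- map (plug M S) c | M + i < y] = map (plug M S) [seq x <- c | size S + i < x].
Proof.
move=> SM /allP c0; rewrite filter_map; congr map; apply: eq_in_filter => x /c0 x0 /=.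
have [xS|xS] := leqP x (size S); last by rewrite plug_gt //; lia.
have := @plug_leq M S x 0 SM; rewrite !addn0 x0 xS => /(_ isT) pM.
by lia.
Qed.

Lemma contains_filter_plug M S i c p :
  all (fun y => y <= M) S -> sorted ltn S -> all (fun y => 0 < y) c ->
  contains [seq y <- map (plug M S) c | M + i < y] p <->
  contains [seq x <- c | size S + i < x] p.
Proof.
move=> SM sS c0; rewrite filter_plug //; apply: contains_map => x y.
rewrite !mem_filter => /andP[_ /(allP c0) x0] /andP[_ /(allP c0) y0].
by rewrite plug_ltn.
Qed.

(** The code [c] starts with [n.+1], the code of the first new letter [t] after [q]. The two
    containment clauses say that [t] is the largest threshold leaving a copy of [tau]. They are
    stated on [c], so they persist when [q] is replaced by a partition with as many components. *)
Definition suffix_dec (tau p c q : seq nat) : Prop :=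
  let n := ncomp q in
  [/\ ncp q, ncp_from n (iota 1 n) c, p = q ++ map (plug (nblocks q) (stk [::] q)) c
    & [/\ exists c', c = n.+1 :: c', contains [seq x <- c | n < x] tau
        & ~ contains [seq x <- c | n.+1 < x] tau]].

Lemma iota_pos n : all (fun y => 0 < y) (iota 1 n).
Proof. by apply/allP => x; rewrite mem_iota => /andP[]. Qed.

Lemma ncp_from_plug_iota q c : all (fun y => 0 < y) c ->
  ncp_from (nblocks q) (stk [::] q) (map (plug (nblocks q) (stk [::] q)) c) =
  ncp_from (ncomp q) (iota 1 (ncomp q)) c.
Proof.
move=> c0; have := @ncp_from_plug (nblocks q) (stk [::] q) 0 (iota 1 (ncomp q)) c.
rewrite /ncomp map_plug_iota !addn0; apply=> //; first exact: stk_leq.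
  exact: stk_sorted.
by apply/allP => x; rewrite mem_iota; lia.
Qed.

Lemma suffix_dec_pos tau p c q : suffix_dec tau p c q -> all (fun y => 0 < y) c.
Proof. by case=> _ /ncp_from_pos h _ _; apply: h; apply: iota_pos. Qed.

Lemma suffix_dec_ncp tau p c q : suffix_dec tau p c q ->
  [/\ ncp p, ncp q & ncomp p = size (stk (iota 1 (ncomp q)) c)].
Proof.
move=> D; have c0 := suffix_dec_pos D; case: D => nq nc -> _.
rewrite ncp_cat nq ncp_from_plug_iota //; split=> //.
rewrite {1}/ncomp stk_cat -{1}(map_plug_iota (nblocks q) (stk [::] q)) stk_plug ?size_map //.
- exact: stk_leq.
- exact: stk_sorted.
exact: iota_pos.
Qed.

Lemma suffix_dec_filter tau p c q i : suffix_dec tau p c q ->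
  contains [seq y <- map (plug (nblocks q) (stk [::] q)) c | nblocks q + i < y] tau <->
  contains [seq x <- c | ncomp q + i < x] tau.
Proof.
move=> /suffix_dec_pos c0; apply: contains_filter_plug => //; first exact: stk_leq.
exact: stk_sorted.
Qed.

Lemma suffix_dec_head tau p c q : suffix_dec tau p c q -> exists w,
  [/\ map (plug (nblocks q) (stk [::] q)) c = (nblocks q).+1 :: w,
      p = q ++ (nblocks q).+1 :: w,
      contains [seq y <- (nblocks q).+1 :: w | nblocks q < y] tau
    & ~ contains [seq y <- (nblocks q).+1 :: w | (nblocks q).+1 < y] tau].
Proof.
move=> D; have h0 := suffix_dec_filter 0 D; have h1 := suffix_dec_filter 1 D.
rewrite !addn0 in h0; rewrite !addn1 in h1.
case: D => _ _ -> [[c' ec] /h0 h2 h3]; exists (map (plug (nblocks q) (stk [::] q)) c').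
have eM : map (plug (nblocks q) (stk [::] q)) c
    = (nblocks q).+1 :: map (plug (nblocks q) (stk [::] q)) c'.
  by rewrite ec /= plug_gt /ncomp ?ltnSn // subSnn add1n.
rewrite -eM; split=> //; by move/h1.
Qed.

(** Suppose the copy of [s] ends in a part [a] of [p] that reaches beyond [q], and let [z] be the
    first, hence smallest, letter of the copy of [tau]. Maximality of [t] gives [z <= t]. A letter
    below [z] after the first [t] would force the later [z] to exceed [t]. So the letters of [a]
    below [z], and with them the copy of [s], lie in [q]. *)
Lemma suffix_dec_contains tau s p c q : is_part tau -> tau != [::] ->
  suffix_dec tau p c q -> contains p (pbracket s tau) <-> contains q s.
Proof.
move=> ptau tau0 D; have [np _ _] := suffix_dec_ncp D.
have [w [_ ep h0 h1]] := suffix_dec_head D; set t := (nblocks q).+1 in ep h0 h1.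
have tpos : all (fun x => 0 < x) tau by apply/allP => x; apply: is_part_pos.
rewrite contains_bracket //; split; last first.
  move=> /containsP[q1 h2 o2]; have /containsP[q2 h3 o3] := h0.
  exists q1, q2; split=> //.
    by rewrite ep cat_subseq //; apply: subseq_trans h3 (filter_subseq _ _).
  move=> x y /(mem_subseq h2)/leq_nblocks xM /(mem_subseq h3).
  by rewrite mem_filter => /andP[yM _]; apply: leq_ltn_trans yM.
move=> [q1 [q2 [qs o1 o2 lt]]]; have [a [b [e s1 s2]]] := subseq_cat_split qs.
apply/containsP; exists q1 => //; have := esym ep; rewrite e => e'.
have [aq|qa] := leqP (size a) (size q).
  have [d -> _] := cat_prefix (esym e') aq.
  exact: subseq_trans s1 (prefix_subseq _ _).
have [[|t' d] ea ew] := cat_prefix e' (ltnW qa); first by rewrite ea cats0 ltnn in qa.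
case: ew => tt' ew; rewrite -{t'}tt' in ea.
case: q2 o2 s2 lt {qs} => [[sz _]|z q2 o2 s2 lt]; first by case: (tau) tau0 sz.
(* A growth word starts with its least letter 1. *)
have zmin x : x \in z :: q2 -> z <= x.
  move=> /(nthP 0)[i iq <-]; rewrite leqNgt; apply/negP => lti.
  have := (proj2 o2) i 0 iq isT; rewrite /= lti.
  have [sz _] := o2; case: (tau) ptau tpos sz => // u v /andP[/andP[u0 u1] _] vp sz.
  have : nth 0 (u :: v) i \in u :: v by apply: mem_nth; rewrite -sz.
  by move=> /(allP vp) /=; lia.
have zb : z \in b by apply: (mem_subseq s2); rewrite mem_head.
have zt : z <= t.
  rewrite leqNgt; apply/negP => tz; apply: h1.
  apply/containsP; exists (z :: q2) => //; rewrite ew -cat_cons filter_cat.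
  apply: subseq_trans (suffix_subseq _ _); rewrite subseq_filter s2 andbT.
  by apply/allP => x /zmin; apply: leq_trans.
have low y : y \in t :: d -> z <= y.
  rewrite inE => /orP[/eqP->//|yd]; rewrite leqNgt; apply/negP => yz.
  case/splitPr: yd ea ew => d1 d2 ea ew.
  have /ncp_new_after/(_ yz) : ncp ((q ++ t :: d1) ++ y :: d2 ++ b).
    by move: np; rewrite e ea -!catA !cat_cons -!catA !cat_cons.
  rewrite mem_cat zb orbT => /(_ isT); rewrite nblocks_cat /=; lia.
have : subseq q1 [seq y <- a | y < z].
  rewrite subseq_filter s1 andbT; apply/allP => y yq; apply: lt => //.
  exact: mem_head.
rewrite ea filter_cat (_ : [seq y <- t :: d | y < z] = [::]) ?cats0.
  by move/subseq_trans; apply; apply: filter_subseq.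
apply: filter_eq_nil => y /low.
by rewrite -leqNgt.
Qed.

Lemma suffix_dec_inj tau p c q c' q' :
  suffix_dec tau p c q -> suffix_dec tau p c' q' -> c = c' /\ q = q'.
Proof.
(* If [q2] were longer, it would include the letter [nblocks q1 + 1] that follows [q1]. Then the
   letters above [nblocks q2] would give a copy of [tau] strictly above that letter, against its
   maximality. *)
have small c1 q1 c2 q2 : suffix_dec tau p c1 q1 -> suffix_dec tau p c2 q2 -> size q2 <= size q1.
  move=> D1 D2; rewrite leqNgt; apply/negP => lt.
  have [w1 [_ e1 _ h1]] := suffix_dec_head D1; have [w2 [_ e2 h2 _]] := suffix_dec_head D2.
  have [[|t d] eq ew] := cat_prefix (etrans (esym e1) e2) (ltnW lt).
    by rewrite eq cats0 ltnn in lt.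
  case: ew => et ew; apply: h1; apply: contains_subseq h2.
  rewrite ew -cat_cons.
  rewrite filter_cat; apply: subseq_trans (suffix_subseq _ _).
  rewrite subseq_filter; apply/andP; split; last exact: filter_subseq.
  apply/allP => y; rewrite mem_filter => /andP[qy _]; apply: leq_ltn_trans qy.
  by rewrite eq nblocks_cat /=; lia.
move=> D D'; have sq : size q = size q'.
  by apply/eqP; rewrite eqn_leq (small _ _ _ _ D D') (small _ _ _ _ D' D).
have c0 := suffix_dec_pos D; have c0' := suffix_dec_pos D'.
case: D => _ _ e _; case: D' => _ _ e' _.
move: e; rewrite e' => /eqP; rewrite eqseq_cat // => /andP[/eqP eq /eqP ec]; split=> //.
rewrite eq in ec; have canc d : all (fun y => 0 < y) d ->
    map (unplug (nblocks q) (stk [::] q)) (map (plug (nblocks q) (stk [::] q)) d) = d.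
  move=> /allP d0; rewrite -map_comp -[RHS]map_id; apply/eq_in_map => x /d0 x0.
  by rewrite /= plugK //; [apply: stk_leq|apply: stk_sorted].
by rewrite -(canc c c0) -(canc c' c0') -ec.
Qed.

Lemma suffix_dec_exists tau p : tau != [::] -> ncp p -> contains p tau ->
  exists c q, suffix_dec tau p c q.
Proof.
move=> tau0 np hp.
(* The least bound above which no copy of [tau] remains is the wanted letter. It is not 0 because
   all letters are positive, and it occurs in [p] since otherwise lowering it by one would select
   the same letters. *)
have [|t [ht mt]] := @ex_least (fun i => ~ contains [seq y <- p | i < y] tau).
  exists (nblocks p); rewrite (_ : filter _ _ = [::]).
    by case=> m [sm [sz _]]; move: sm sz tau0; case: m => // _; case: (tau).
  apply: filter_eq_nil => y /leq_nblocks.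
  by rewrite -leqNgt.
case: t ht mt => [|t] ht mt.
  case: ht; rewrite (_ : filter _ _ = p) //.
  by apply/all_filterP; have := ncp_pos np.
have {}mt : contains [seq y <- p | t < y] tau by apply: NNPP; apply: mt.
have tp : t.+1 \in p.
  apply/negPn/negP => tp; apply: ht; rewrite (_ : filter _ _ = [seq y <- p | t < y]) //.
  apply: eq_in_filter => y yp; rewrite [RHS]leq_eqVlt.
  by case: eqP => // ty; rewrite ty yp in tp.
have [q [w [e tq]]] : exists q w, p = q ++ t.+1 :: w /\ t.+1 \notin q.
  exists (take (index t.+1 p) p), (drop (index t.+1 p).+1 p); split.
    by rewrite -[LHS](cat_take_drop (index t.+1 p)) (drop_nth 0) ?index_mem // nth_index.
  by rewrite in_take_leq ?index_size // ltnn.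
have [nq nw] : ncp q /\ ncp_from (nblocks q) (stk [::] q) (t.+1 :: w).
  by move: np; rewrite e ncp_cat => /andP.
(* The letter [t.+1] is absent from [q], so the machine accepts it only as a new maximum. *)
have eM : t = nblocks q.
  case/andP: nw => /orP[/mem_stk|/eqP[]//].
  by rewrite (negPf tq).
rewrite {t}eM in ht mt tp tq e nw.
set M := nblocks q in ht mt tp tq e nw; set S := stk [::] q in nw.
have SM : all (fun y => y <= M) S by apply: stk_leq.
have sS : sorted ltn S by apply: stk_sorted.
pose c := map (unplug M S) (M.+1 :: w).
have ec : map (plug M S) c = M.+1 :: w.
  rewrite -map_comp -[RHS]map_id; apply/eq_in_map => y /(ncp_from_mem nw) yS.
  exact: unplugK.
have c0 : all (fun y => 0 < y) c.
  apply/allP => _ /mapP[y _ ->]; rewrite /unplug; case: (leqP y M) => //; lia.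
have fE i : [seq y <- map (plug M S) c | M + i < y] = [seq y <- p | M + i < y].
  rewrite ec e filter_cat (_ : filter _ q = [::]) //.
  apply: filter_eq_nil => y /leq_nblocks; lia.
have f0 := contains_filter_plug 0 tau SM sS c0; have f1 := contains_filter_plug 1 tau SM sS c0.
rewrite fE !addn0 in f0; rewrite fE !addn1 in f1.
exists c, q; split=> //.
- by rewrite -ncp_from_plug_iota // -/M -/S ec.
- by rewrite -/M -/S ec.
split; [|exact/f0|by move/f1].
exists (map (unplug M S) w); rewrite /c /= /unplug ltnn /=.
by rewrite subSnn.
Qed.

Lemma cc_equiv_suffix tau r r' : is_part tau -> tau != [::] -> cc_equiv r r' ->
  cc_equiv (pbracket r tau) (pbracket r' tau).
Proof.
move=> ptau tau0.
have tpos : all (fun x => 0 < x) tau by apply/allP => x; apply: is_part_pos.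
apply: (@cc_equiv_context _ (suffix_dec tau) (fun s => pbracket s tau)).
- by move=> p c q /suffix_dec_ncp[].
- exact: suffix_dec_inj.
- by move=> p p' c q [_ _ -> _] [].
- move=> p c q q' [nq nc _ hc] nq' e.
  by exists (q' ++ map (plug (nblocks q') (stk [::] q')) c); split; rewrite ?e.
- move=> p p' c q q' D D' sz e.
  have [_ _ ->] := suffix_dec_ncp D; have [_ _ ->] := suffix_dec_ncp D'.
  case: D => _ _ -> _; case: D' => _ _ -> _.
  by rewrite !size_cat !size_map sz e.
- by move=> s p c q _; apply: suffix_dec_contains.
move=> s p _ np nD /(contains_bracketr tpos)/(suffix_dec_exists tau0 np)[c [q D]].
exact: nD D.
Qed.

Theorem theorem3p2 (sigma tau rho rho' : seq nat) :
  is_part sigma -> noncrossing sigma ->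
  is_part tau -> noncrossing tau ->
  is_part rho -> noncrossing rho ->
  is_part rho' -> noncrossing rho' ->
  cc_equiv rho rho' ->
  cc_equiv (pbracket (pbracket sigma rho) tau) (pbracket (pbracket sigma rho') tau).
Proof.
move=> _ _ ptau _ prho _ prho' _ h.
(* First the prefix is attached, then [tau] is appended to [sigma[rho]]; an empty [sigma] or [tau]
   changes nothing. *)
have {}h : cc_equiv (pbracket sigma rho) (pbracket sigma rho').
  have [->|s0] := eqVneq sigma [::]; last exact: cc_equiv_prefix.
  have id0 s : pbracket [::] s = s by rewrite /pbracket /= -[RHS]map_id; apply: eq_map.
  by rewrite !id0.
have [->|t0] := eqVneq tau [::]; last exact: cc_equiv_suffix.
by rewrite /pbracket /= !cats0.
Qed.
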